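(* Let $(G,+)$ be a group (not necessarily abelian) with identity $0_G$, let $R$ be a reflexive relation on $G$, and let $A,B$ be nonempty subsets of $G$ with $A+B\neq A$. Assume that $R$ is isotone and that $\mathscr{E}(A)$ is nonempty. If there exists a point $b^{\circ}\in B$ such that $b^{\circ}P0_G$, then $\mathscr{E}(A+B)\neq\mathscr{E}(A)$.
   Context: For $x,y\in G$, $xPy$ means that $xRy$ holds and $yRx$ does not. $R$ is isotone if for all $g,g',z\in G$, $gRg'$ implies $(z+g)R(z+g')$ and $(g+z)R(g'+z)$. The sum set is $A+B=\{a+b: a\in A, b\in B\}$. For $S\subseteq G$, $\mathscr{E}(S)$ is the set of efficient points of $S$, i.e. of those $g\in S$ for which there is no $g'\in S$ with $g'Pg$; by convention $\mathscr{E}(\emptyset)=\emptyset$. *)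

(* Defs.v *)
From mathcomp Require Import all_boot.
From mathcomp Require Import classical_sets.

Set Implicit Arguments.
Unset Strict Implicit.
Unset Printing Implicit Defensive.

Local Open Scope classical_set_scope.
Local Open Scope group_scope.

(* The ambient group need not be abelian, while addition is commutative in
   every additive structure of the library. So we work over groupType, whose
   law is written multiplicatively: x * y and 1 stand for x + y and 0_G. *)

Definition strict_part (T : Type) (R : T -> T -> Prop) (x y : T) : Prop :=
  R x y /\ ~ R y x.

Definition isotone (G : groupType) (R : G -> G -> Prop) : Prop :=
  forall g g' z : G, R g g' -> R (z * g) (z * g') /\ R (g * z) (g' * z).

(* The sum set A + B of the additive notation. *)
Definition sumset (G : groupType) (A B : set G) : set G :=
  [set a * b | a in A & b in B].

Definition efficient (T : Type) (R : T -> T -> Prop) (S : set T) : set T :=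
  [set g | S g /\ ~ (exists2 g', S g' & strict_part R g' g)].

(* Main.v *)
Require Import Defs.
From mathcomp Require Import all_boot.
From mathcomp Require Import classical_sets.

Set Implicit Arguments.
Unset Strict Implicit.
Unset Printing Implicit Defensive.

Local Open Scope classical_set_scope.
Local Open Scope group_scope.

(** An efficient point [a] of [A] cannot stay efficient in the sum set: since
    left translation preserves strict preference ([strict_part_mul2l]), moving
    [a] by the point of [B] strictly preferred to the identity gives a point of
    the sum set strictly preferred to [a]. Thus the efficient sets of [A] and of
    the sum set are disjoint ([efficient_sumset_disjoint]), and they can only
    coincide if both are empty. *)

(** Isotonicity alone gives the weak half. For the strict half, a reverse
    comparison of the translates could be translated back by [z^-1]. *)
Lemma strict_part_mul2l (G : groupType) (R : G -> G -> Prop) (z g g' : G) :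
  isotone R -> strict_part R g g' -> strict_part R (z * g) (z * g').
Proof.
move=> isoR [Rgg' nRg'g]; split; first by have [] := isoR _ _ z Rgg'.
by move=> /(isoR _ _ z^-1)[]; rewrite !mulKg.
Qed.

Lemma efficient_sumset_disjoint (G : groupType) (R : G -> G -> Prop)
    (A B : set G) (a b : G) :
  isotone R -> B b -> strict_part R b 1 -> A a -> ~ efficient R (sumset A B) a.
Proof.
move=> isoR Bb Pb1 Aa [_]; apply; exists (a * b).
  by exists a => //; exists b.
by have := strict_part_mul2l a isoR Pb1; rewrite mulg1.
Qed.

Theorem theorem4 (G : groupType) (R : G -> G -> Prop) (A B : set G)
    (R_refl : forall g : G, R g g)
    (A_neq0 : A !=set0) (B_neq0 : B !=set0)
    (AB_neqA : sumset A B <> A)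
    (R_isotone : isotone R)
    (EA_neq0 : efficient R A !=set0)
    (B_gt0 : exists2 b : G, B b & strict_part R b 1) :
  efficient R (sumset A B) <> efficient R A.
Proof.
move=> EAB_eq; have [a Ea] := EA_neq0; have [b Bb Pb1] := B_gt0.
have [Aa _] := Ea.
by apply: (efficient_sumset_disjoint R_isotone Bb Pb1 Aa); rewrite EAB_eq.
Qed.
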